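(* Let $\mathcal H,\mathfrak H$ be complex separable Hilbert spaces, let $A$ be a densely defined, symmetric operator acting in $\mathcal H$ with $\dim\ker(A^*-i)=\dim\ker(A^*+i)$, and let $(\mathfrak H,\Gamma_1,\Gamma_2)$ be a boundary triple for $A$. The map $$\widetilde{\operatorname{Tr}}_{\mathfrak H}:\operatorname{dom}(A^* )/\operatorname{dom}(A)\to\mathfrak H\times\mathfrak H,\qquad[x]\mapsto(\Gamma_1x,\Gamma_2x),$$ is well defined, bounded, has bounded inverse, and $$\omega_{\mathcal H}([x],[y])=\omega_{\mathfrak H}\big(\widetilde{\operatorname{Tr}}_{\mathfrak H}[x],\widetilde{\operatorname{Tr}}_{\mathfrak H}[y]\big),\quad[x],[y]\in\operatorname{dom}(A^* )/\operatorname{dom}(A).$$ That is, $\widetilde{\operatorname{Tr}}_{\mathfrak H}$ is a symplectomorphism of $(\operatorname{dom}(A^* )/\operatorname{dom}(A),\omega_{\mathcal H})$ onto $(\mathfrak H\times\mathfrak H,\omega_{\mathfrak H})$.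
   Context: Boundary triple: $(\mathfrak H,\Gamma_1,\Gamma_2)$ with linear maps $\Gamma_1,\Gamma_2:\operatorname{dom}(A^* )\to\mathfrak H$ is a boundary triple for $A$ if (1) $\langle A^*f,g\rangle_{\mathcal H}-\langle f,A^*g\rangle_{\mathcal H}=\langle\Gamma_1f,\Gamma_2g\rangle_{\mathfrak H}-\langle\Gamma_2f,\Gamma_1g\rangle_{\mathfrak H}$ for all $f,g\in\operatorname{dom}(A^* )$, and (2) $(\Gamma_1,\Gamma_2):\operatorname{dom}(A^* )\to\mathfrak H\times\mathfrak H$ is onto. $\operatorname{dom}(A^* )$ carries the graph norm $\|x\|^2_{A^*}=\|x\|^2_{\mathcal H}+\|A^*x\|^2_{\mathcal H}$ and $\operatorname{dom}(A^* )/\operatorname{dom}(A)$ the corresponding quotient norm; $[x]$ is the class of $x$. Symplectic forms: $\omega_{\mathcal H}([x],[y])=\langle A^*x,y\rangle_{\mathcal H}-\langle x,A^*y\rangle_{\mathcal H}$ on $\operatorname{dom}(A^* )/\operatorname{dom}(A)$, and $\omega_{\mathfrak H}((f_1,g_1),(f_2,g_2))=\langle f_1,g_2\rangle_{\mathfrak H}-\langle g_1,f_2\rangle_{\mathfrak H}$ on $\mathfrak H\times\mathfrak H$.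
   Formalization: The operator A is additionally assumed to be closed; for a non-closed A the map vanishes on the nonzero subspace dom(closure of A)/dom(A), so it has no inverse and the claim as written fails. *)

(* Defs.v *)
From HB Require Import structures.
From mathcomp Require Import all_boot all_order all_algebra.
From mathcomp Require Import ring_quotient sesquilinear complex.
From mathcomp Require Import ring.
From mathcomp Require Import all_classical all_reals all_analysis.

Set Implicit Arguments.
Unset Strict Implicit.
Unset Printing Implicit Defensive.

Import Order.TTheory GRing.Theory Num.Theory numFieldNormedType.Exports.

Local Open Scope classical_set_scope.
Local Open Scope ring_scope.
Local Open Scope complex_scope.
Local Open Scope quotient_scope.

(* Inner products are linear in the first and conjugate-linear in the second
   argument. *)
HB.mixin Record isHilbert (R : realType) H
    of CompleteNormedModule R[i] H := {
  inner : {dot H for @Num.conj R[i]};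
  inner_norm : forall x : H, inner x x = `|x| ^+ 2
}.

#[short(type="hilbertType")]
HB.structure Definition Hilbert (R : realType) :=
  {H of CompleteNormedModule R[i] H & isHilbert R H}.

Notation "'<[' x , y ]>" := (inner x y)
  (at level 0, x, y at level 99, format "'<[' x ,  y ]>") : ring_scope.

Definition separable (T : topologicalType) :=
  exists2 S : set T, countable S & dense S.

(* The norm of a normed module over R[i] is R[i]-valued. *)
Definition rnorm (R : realType) (V : normedModType R[i]) (x : V) : R :=
  complex.Re `|x|.

Section SubLmod.
Variables (R : realType) (V : lmodType R[i]).

Record sublmod (D : submodClosed V) :=
  SubLmod { sublmod_val :> V; _ : sublmod_val \in D }.

Variable D : submodClosed V.

HB.instance Definition _ := [isSub for @sublmod_val D].
HB.instance Definition _ := [Choice of sublmod D by <:].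
HB.instance Definition _ := [SubChoice_isSubLmodule of sublmod D by <:].

End SubLmod.

Section Adjoint.
Variables (R : realType) (H : hilbertType R) (D : submodClosed H).
Variable A : {linear sublmod D -> H}.

Definition adj_dom : {pred H} :=
  fun y => `[< exists z : H, forall x : sublmod D, <[A x, y]> = <[val x, z]> >].

Lemma adj_dom_submod : submod_closed adj_dom.
Proof.
split.
  by apply/asboolP; exists 0 => x; rewrite !linear0.
move=> a u v /asboolP[z hz] /asboolP[w hw]; apply/asboolP.
by exists (a *: z + w) => x; rewrite !linearP /= hz hw.
Qed.

HB.instance Definition _ := GRing.isSubmodClosed.Build R[i] H adj_dom adj_dom_submod.

Lemma adjP (y : sublmod adj_dom) :
  exists z : H, forall x : sublmod D, <[A x, val y]> = <[val x, z]>.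
Proof. exact/asboolP/(valP y). Qed.

(* When the domain D of A is dense, z is unique and this is the adjoint A^*. *)
Definition adj (y : sublmod adj_dom) : H := projT1 (cid (adjP y)).

Lemma adjE (x : sublmod D) (y : sublmod adj_dom) :
  <[A x, val y]> = <[val x, adj y]>.
Proof. by rewrite /adj; case: cid. Qed.

(* dom(A) seen as a submodule of dom(A^* ); for symmetric A nothing is lost,
   since then dom(A) is contained in dom(A^* ). *)
Definition dom_in_adj : {pred sublmod adj_dom} := fun x => val x \in D.

Lemma dom_in_adjE x : (x \in dom_in_adj) = (val x \in D). Proof. by []. Qed.

Lemma dom_in_adj_submod : submod_closed dom_in_adj.
Proof.
split; first by rewrite dom_in_adjE linear0 rpred0.
by move=> a u v; rewrite !dom_in_adjE linearP => Du Dv; rewrite rpredD ?rpredZ.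
Qed.

HB.instance Definition _ :=
  GRing.isSubmodClosed.Build R[i] (sublmod adj_dom) dom_in_adj dom_in_adj_submod.

Definition dom_quot : Type := Quotient.quot dom_in_adj.

HB.instance Definition _ := GRing.Zmodule.on dom_quot.
HB.instance Definition _ := EqQuotient.on dom_quot.
HB.instance Definition _ := ZmodQuotient.on dom_quot.

Lemma pi_dom_quotP (x y : sublmod adj_dom) :
  reflect (\pi_dom_quot x = \pi_dom_quot y) (val x - val y \in D).
Proof.
apply: (iffP idP) => [h|/eqP].
  by apply/eqP; rewrite -Quotient.idealrBE dom_in_adjE linearB.
by rewrite -Quotient.idealrBE dom_in_adjE linearB.
Qed.

Definition dom_quot_scale (a : R[i]) (q : dom_quot) : dom_quot :=
  \pi_dom_quot (a *: repr q).

Lemma dom_quot_scaleE a x :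
  dom_quot_scale a (\pi_dom_quot x) = \pi_dom_quot (a *: x).
Proof.
apply/pi_dom_quotP; rewrite -linearB -scalerBr linearZ rpredZ // linearB.
by apply/pi_dom_quotP; rewrite reprK.
Qed.

Fact dom_quot_scaleA a b q :
  dom_quot_scale a (dom_quot_scale b q) = dom_quot_scale (a * b) q.
Proof. by elim/quotW: q => x; rewrite (dom_quot_scaleE b) !dom_quot_scaleE scalerA. Qed.

Fact dom_quot_scale1 : left_id 1 dom_quot_scale.
Proof. by elim/quotW=> x; rewrite dom_quot_scaleE scale1r. Qed.

Fact dom_quot_scaleDr : right_distributive dom_quot_scale +%R.
Proof.
move=> a; elim/quotW=> x; elim/quotW=> y; rewrite -raddfD !dom_quot_scaleE.
by rewrite scalerDr raddfD.
Qed.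

Fact dom_quot_scaleDl q : {morph dom_quot_scale^~ q : a b / a + b}.
Proof. by elim/quotW: q => x a b; rewrite !dom_quot_scaleE scalerDl raddfD. Qed.

HB.instance Definition _ := GRing.Zmodule_isLmodule.Build R[i] dom_quot
  dom_quot_scaleA dom_quot_scale1 dom_quot_scaleDr dom_quot_scaleDl.

Definition graph_norm (x : sublmod adj_dom) : R :=
  Num.sqrt (rnorm (val x) ^+ 2 + rnorm (adj x) ^+ 2).

Definition quot_norm (q : dom_quot) : R :=
  inf [set graph_norm x | x in [set x | \pi_dom_quot x = q]].

Definition omega_dom (q r : dom_quot) : R[i] :=
  <[adj (repr q), val (repr r)]> - <[val (repr q), adj (repr r)]>.

Definition densely_defined := dense [set` D].

Definition symmetric_op :=
  forall x y : sublmod D, <[A x, val y]> = <[val x, A y]>.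

Definition closed_op := closed [set (val x, A x) | x in [set: sublmod D]].

Definition ker_adj_sub (z : R[i]) : set H :=
  [set val x | x in [set x : sublmod adj_dom | adj x - z *: val x = 0]].

Hypotheses (dA : densely_defined) (sA : symmetric_op).

Lemma adj_unique (y : sublmod adj_dom) (z : H) :
  (forall x : sublmod D, <[A x, val y]> = <[val x, z]>) -> adj y = z.
Proof.
move=> yz; set w := adj y - z.
have xw (x : sublmod D) : <[val x, w]> = 0.
  by rewrite /w linearB /= -adjE yz subrr.
apply/eqP; rewrite -subr_eq0 -/w; apply/negP => /negP w0.
have [|x [/= xb xD]] := dA (O := ball w `|w|) _ (ball_open _ _).
  by exists w; apply: ballxx; rewrite normr_gt0.
have wx : <[w, x]> = 0
  by rewrite hermC; have /= -> := xw (SubLmod xD); rewrite rmorph0 mulr0.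
move: xb; rewrite -ball_normE /= => /lt_geF /negP; apply.
rewrite -(@ler_pXn2r _ 2) ?nnegrE ?normr_ge0 // -!inner_norm (hnormBd wx).
by rewrite lerDl dnorm_ge0.
Qed.

Lemma adj_linear : linear adj.
Proof.
move=> a x y; apply: adj_unique => u.
have -> : val (a *: x + y) = a *: val x + val y by exact: linearP.
by rewrite !linearP /= !adjE.
Qed.

Lemma adj_restr (x : sublmod adj_dom) (u : sublmod D) :
  val x = val u -> adj x = A u.
Proof. by move=> xu; apply: adj_unique => v; rewrite xu sA. Qed.

(* omega_dom does not depend on the representatives. *)
Lemma omega_domE (x y : sublmod adj_dom) :
  omega_dom (\pi_dom_quot x) (\pi_dom_quot y) =
  <[adj x, val y]> - <[val x, adj y]>.
Proof.
have repE z : exists2 u : sublmod D, val (repr (\pi_dom_quot z)) = val z + val u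
    & adj (repr (\pi_dom_quot z)) = adj z + A u.
  set r := repr _.
  have rz : val r - val z \in D by apply/pi_dom_quotP; rewrite reprK.
  exists (SubLmod rz); first by rewrite /= addrC subrK.
  have <- : adj (r - z) = A (SubLmod rz) by apply: adj_restr; rewrite linearB.
  have -> : adj (r - z) = adj r - adj z.
    by have := adj_linear (-1) z r; rewrite !scaleN1r ![- _ + _]addrC.
  by rewrite addrC subrK.
rewrite /omega_dom; have [u -> ->] := repE x; have [v -> ->] := repE y.
have xv : <[adj x, val v]> = <[val x, A v]>
  by rewrite hermC [RHS]hermC; congr (_ * Num.conj _); exact/esym/adjE.
have innerDr (a b c : H) : <[a, b + c]> = <[a, b]> + <[a, c]>.
  exact: linearDr.
have innerDl (a b c : H) : <[a + b, c]> = <[a, c]> + <[b, c]>.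
  exact: linearDl.
rewrite !innerDr !innerDl xv adjE sA.
set a := <[adj x, _]>; set b := <[val x, adj y]>; set c := <[val x, A v]>.
by ring.
Qed.

End Adjoint.

Section HilbertDimension.
Variables (R : realType) (H : hilbertType R).

Definition closed_span (B : set H) : set H :=
  [set x | forall W : submodClosed H,
             closed [set` W] -> B `<=` [set` W] -> x \in W].

Definition orthonormal_basis (B V : set H) :=
  [/\ B `<=` V, V `<=` closed_span B &
      forall b c, B b -> B c -> <[b, c]> = (`[< b = c >])%:R].

(* The Hilbert dimension of V is the cardinality of any of its orthonormal
   bases. *)
Definition same_dim (V W : set H) :=
  exists B C : set H,
    [/\ orthonormal_basis B V, orthonormal_basis C W & (B #= C)%card].

End HilbertDimension.

Section BoundaryTriple.
Variables (R : realType) (H : hilbertType R) (D : submodClosed H).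
Variable A : {linear sublmod D -> H}.
Variable G : hilbertType R.
Variables G1 G2 : {linear sublmod (adj_dom A) -> G}.

Definition boundary_triple :=
  (forall f g : sublmod (adj_dom A),
     <[adj f, val g]> - <[val f, adj g]> = <[G1 f, G2 g]> - <[G2 f, G1 g]>) /\
  (forall u v : G, exists f : sublmod (adj_dom A), G1 f = u /\ G2 f = v).

(* The Hilbert norm of the orthogonal sum G x G, not the maximum norm that the
   library puts on a product. *)
Definition pair_norm (p : G * G) : R :=
  Num.sqrt (rnorm p.1 ^+ 2 + rnorm p.2 ^+ 2).

Definition omega_pair (p q : G * G) : R[i] := <[p.1, q.2]> - <[p.2, q.1]>.

End BoundaryTriple.

Definition bounded_map (R : realType) (U V : Type) (normU : U -> R)
    (normV : V -> R) (f : U -> V) :=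
  exists M : R, forall x, normV (f x) <= M * normU x.

(* Main.v *)
Require Import Defs.
From HB Require Import structures.
From mathcomp Require Import all_boot all_order all_algebra.
From mathcomp Require Import ring_quotient sesquilinear complex.
From mathcomp Require Import ring lra.
From mathcomp Require Import all_classical all_reals all_analysis.

Set Implicit Arguments.
Unset Strict Implicit.
Unset Printing Implicit Defensive.

Import Order.TTheory GRing.Theory Num.Theory numFieldNormedType.Exports.

Local Open Scope classical_set_scope.
Local Open Scope ring_scope.
Local Open Scope quotient_scope.

(** Write Γ = (Γ1, Γ2) and equip H ⊕ H with the Hilbert norm, so that the
    graph norm of x is the norm of (x, A^* x). Both symplectic forms become
    one form ω on an orthogonal sum, and ω(p, q) = ⟨p, Jq⟩ for the isometry
    J(a, b) = (b, - a) ([twist]). Green's identity then says that x ↦ Γx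
    carries ω from the graph of A^* to G ⊕ G, up to a sign.

    Well-definedness. Only the class of x in dom(A^* )/dom(A) enters ω, and
    ω is nondegenerate on G ⊕ G, where every vector is some Γy; hence Γx
    depends only on the class of x ([trace_pi]).

    Boundedness. For fixed p = JΓy, Green's identity and Cauchy-Schwarz give
    |⟨Γx, p⟩| <= |x| |y| in the graph norms. So the vectors Γx with |x| <= 1
    form a weakly bounded set in a Hilbert space, and the uniform boundedness
    principle yields |Γx| <= M |x| ([trace_bounded]).

    Bounded inverse. The graph of A is closed, so projecting (x, A^* x) onto
    it replaces x by a z of the same class whose graph vector is orthogonal
    to the graph of A ([von_neumann_decomposition]). This orthogonality says
    that w = A^* z lies in dom(A^* ) with A^* w = - z; that is, the graph
    vector of w is J applied to that of z, whence |w| = |z| and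
      |z|^2 = ω_H([z], [w]) = ω_G(Γz, Γw) <= |Γz| |Γw| <= M |Γz| |z|.
    Thus |z| <= M |Γx| ([small_representative]): the bound for Γ already
    yields the bound for the inverse, with the same constant. Injectivity is
    the case Γx = 0, surjectivity is part of the definition of a boundary
    triple, and Green's identity is the invariance of the forms.

    The two tools from Hilbert space theory, the projection onto a closed
    subspace ([orthogonal_projection]) and the uniform boundedness principle
    ([uniform_boundedness]), are proved on H ⊕ H, mostly through its
    underlying real inner product. *)

(** * Real and imaginary parts *)

Lemma ReD (R : realType) (a b : R[i]) :
  complex.Re (a + b) = complex.Re a + complex.Re b.
Proof. by case: a b => [? ?] [? ?]. Qed.

Lemma pos_complex (R : realType) (e : R[i]) :
  0 < e -> exists2 d : R, 0 < d & e = (d%:C)%C.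
Proof.
by case: e => a b; rewrite ltcE /= => /andP[/eqP -> ?]; exists a.
Qed.

Lemma rnormE (R : realType) (V : normedModType R[i]) (x : V) :
  `|x| = ((rnorm x)%:C)%C.
Proof. by rewrite /rnorm RRe_real// normr_real. Qed.

Lemma rnorm_ge0 (R : realType) (V : normedModType R[i]) (x : V) : 0 <= rnorm x.
Proof. by have := normr_ge0 x; rewrite rnormE lecR. Qed.

(** A quadratic polynomial that is nonnegative on the line has nonpositive
    discriminant. This yields the Cauchy-Schwarz inequality, and also the
    near-orthogonality of near-minimizers in the projection theorem. *)
Lemma discr_le (R : realType) (a b c : R) : 0 <= c ->
  (forall t, 0 <= a - 2 * t * b + t ^+ 2 * c) -> b ^+ 2 <= a * c.
Proof.
rewrite le_eqVlt => /predU1P[<- h|c0 h].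
  have [->|b0] := eqVneq b 0; first by rewrite mulr0 expr0n.
  have := h ((a + 1) / (2 * b)); rewrite mulr0 addr0.
  have -> : 2 * ((a + 1) / (2 * b)) * b = a + 1 by field.
  by lra.
have := h (b / c).
have -> : a - 2 * (b / c) * b + (b / c) ^+ 2 * c = a - b ^+ 2 / c.
  by field; rewrite gt_eqF.
by rewrite subr_ge0 ler_pdivrMr.
Qed.

(** * The orthogonal sum of a Hilbert space with itself *)

Section OrthogonalSum.
Variables (R : realType) (H : hilbertType R).
Implicit Types p q r : (H * H)%type.

Definition pair_inner p q : R[i] := inner p.1 q.1 + inner p.2 q.2.

(** The inner product of the underlying real Hilbert space. *)
Definition rdot p q : R := complex.Re (pair_inner p q).

Lemma pair_innerDl p q r :
  pair_inner (p + q) r = pair_inner p r + pair_inner q r.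
Proof. by rewrite /pair_inner !linearDl /= addrACA. Qed.

Lemma pair_innerZl a p q : pair_inner (a *: p) q = a * pair_inner p q.
Proof. by rewrite /pair_inner !linearZl_LR /= mulrDr. Qed.

Lemma pair_innerC p q : pair_inner p q = Num.conj (pair_inner q p).
Proof.
rewrite /pair_inner (hermC _ p.1) (hermC _ p.2) /= !expr0 !mul1r.
by rewrite rmorphD.
Qed.

Lemma rdotC p q : rdot p q = rdot q p.
Proof. by rewrite /rdot pair_innerC; case: (pair_inner q p). Qed.

Lemma rdotDl p q r : rdot (p + q) r = rdot p r + rdot q r.
Proof. by rewrite /rdot pair_innerDl ReD. Qed.

Lemma rdotDr p q r : rdot p (q + r) = rdot p q + rdot p r.
Proof. by rewrite !(rdotC p) rdotDl. Qed.

Lemma rdotZl (t : R) p q : rdot (t%:C%C *: p) q = t * rdot p q.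
Proof.
rewrite /rdot pair_innerZl; case: (pair_inner p q) => ? ? /=.
by rewrite mul0r subr0.
Qed.

Lemma rdotZr (t : R) p q : rdot p (t%:C%C *: q) = t * rdot p q.
Proof. by rewrite !(rdotC p) rdotZl. Qed.

Lemma rdotNl p q : rdot (- p) q = - rdot p q.
Proof. by rewrite -mulN1r -rdotZl rmorphN rmorph1 scaleN1r. Qed.

Lemma rdotNr p q : rdot p (- q) = - rdot p q.
Proof. by rewrite !(rdotC p) rdotNl. Qed.

Lemma rdotpp p : rdot p p = pair_norm p ^+ 2.
Proof.
rewrite /rdot /pair_inner !inner_norm !rnormE -!rmorphXn -rmorphD /=.
by rewrite sqr_sqrtr// addr_ge0// sqr_ge0.
Qed.

Lemma pair_norm_ge0 p : 0 <= pair_norm p.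
Proof. exact: sqrtr_ge0. Qed.

Lemma le_pair_norm1 p : rnorm p.1 <= pair_norm p.
Proof.
rewrite -[leLHS](ger0_norm (rnorm_ge0 _)) -sqrtr_sqr ler_wsqrtr//.
by rewrite lerDl sqr_ge0.
Qed.

Lemma le_pair_norm2 p : rnorm p.2 <= pair_norm p.
Proof.
rewrite -[leLHS](ger0_norm (rnorm_ge0 _)) -sqrtr_sqr ler_wsqrtr//.
by rewrite lerDr sqr_ge0.
Qed.

Lemma pair_norm_le p : pair_norm p <= rnorm p.1 + rnorm p.2.
Proof.
have n1 := rnorm_ge0 p.1; have n2 := rnorm_ge0 p.2.
rewrite -[leRHS]ger0_norm ?addr_ge0// -sqrtr_sqr ler_wsqrtr//.
by rewrite sqrrD; nra.
Qed.

Lemma sqr_pair_normD p q :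
  pair_norm (p + q) ^+ 2 = pair_norm p ^+ 2 + 2 * rdot p q + pair_norm q ^+ 2.
Proof. by rewrite -!rdotpp !rdotDl !rdotDr (rdotC q p); ring. Qed.

Lemma sqr_pair_normBZ p q (t : R) :
  pair_norm (p - t%:C%C *: q) ^+ 2 =
    pair_norm p ^+ 2 - 2 * t * rdot p q + t ^+ 2 * pair_norm q ^+ 2.
Proof.
rewrite sqr_pair_normD -!rdotpp rdotNr rdotNl (rdotNr (_ *: _)) !rdotZl.
by rewrite !rdotZr; ring.
Qed.

Lemma rdot_CauchySchwarz p q : rdot p q <= pair_norm p * pair_norm q.
Proof.
have np := pair_norm_ge0 p; have nq := pair_norm_ge0 q.
have : rdot p q ^+ 2 <= (pair_norm p * pair_norm q) ^+ 2.
  rewrite exprMn; apply: discr_le (sqr_ge0 _) _ => t.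
  by rewrite -sqr_pair_normBZ sqr_ge0.
have pq := mulr_ge0 np nq; move: pq; set c := _ * pair_norm _ => pq h.
by have := sqr_ge0 (rdot p q - c); nra.
Qed.

Lemma pair_normZ (t : R) p : pair_norm (t%:C%C *: p) = `|t| * pair_norm p.
Proof.
apply/eqP; rewrite -(@eqrXn2 _ 2) ?mulr_ge0 ?pair_norm_ge0//.
rewrite -rdotpp rdotZl rdotZr exprMn -rdotpp real_normK ?num_real//.
by apply/eqP; ring.
Qed.

Lemma pair_normN p : pair_norm (- p) = pair_norm p.
Proof.
rewrite -[- p]scaleN1r -(rmorph1 (real_complex R)) -rmorphN pair_normZ.
by rewrite normrN1 mul1r.
Qed.

Lemma rdot_CauchySchwarz_abs p q : `|rdot p q| <= pair_norm p * pair_norm q.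
Proof.
by rewrite ler_norml lerNl -rdotNl -(pair_normN p) rdot_CauchySchwarz pair_normN
   rdot_CauchySchwarz.
Qed.

Lemma pair_normD p q : pair_norm (p + q) <= pair_norm p + pair_norm q.
Proof.
rewrite -(@ler_pXn2r _ 2) ?nnegrE ?addr_ge0 ?pair_norm_ge0//.
by rewrite sqr_pair_normD sqrrD; have := rdot_CauchySchwarz p q; lra.
Qed.

Lemma pair_normB p q : pair_norm (p - q) = pair_norm (q - p).
Proof. by rewrite -pair_normN opprB. Qed.

Lemma pair_norm_eq0 p : pair_norm p = 0 -> p = 0.
Proof.
move=> p0; have n1 := le_pair_norm1 p; have n2 := le_pair_norm2 p.
have e (x : H) : rnorm x <= pair_norm p -> x = 0.
  rewrite p0 => h; apply/eqP; rewrite -normr_eq0 rnormE.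
  by rewrite (le_anti (_ : rnorm x <= 0 <= rnorm x)) ?h ?rnorm_ge0.
by rewrite [p]surjective_pairing (e _ n1) (e _ n2).
Qed.

Lemma pair_norm0 : pair_norm (0 : H * H) = 0.
Proof. by rewrite /pair_norm /= /rnorm normr0 expr0n addr0 sqrtr0. Qed.

Definition pair_cauchy (u : nat -> H * H) := forall e : R, 0 < e ->
  exists N, forall m n, (N <= m)%N -> (N <= n)%N -> pair_norm (u m - u n) < e.

Definition pair_cvg (u : nat -> H * H) l := forall e : R, 0 < e ->
  exists N, forall n, (N <= n)%N -> pair_norm (l - u n) < e.

(** The product topology comes from the maximum norm, which is equivalent to
    the Hilbert norm of the sum. *)
Lemma pair_cvgP (u : nat -> H * H) l : pair_cvg u l <-> u n @[n --> \oo] --> l.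
Proof.
split => [ul|/cvgrPdist_lt ul e e0].
  rewrite [l]surjective_pairing.
  rewrite (_ : (fun n => u n) = fun n => ((u n).1, (u n).2)); last first.
    by apply/funext => n; case: (u n).
  apply: cvg_pair; apply/cvgrPdist_lt => _ /pos_complex[d d0 ->];
    have [N uN] := ul _ d0; exists N => // n /= /uN h; rewrite rnormE ltcR;
    apply: le_lt_trans h.
  - exact: (le_pair_norm1 (l - u n)).
  - exact: (le_pair_norm2 (l - u n)).
have [|N _ uN] := ul ((e / 2)%:C)%C; first by rewrite ltcR divr_gt0.
exists N => n /uN; rewrite prod_normE /=.
rewrite comparable_gt_max ?real_comparable ?normr_real// !rnormE !ltcR.
move=> /andP[h1 h2].
by apply: le_lt_trans (pair_norm_le _) _ => /=; rewrite (splitr e) ltrD.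
Qed.

Lemma pair_complete u : pair_cauchy u -> exists l, pair_cvg u l.
Proof.
move=> uc.
have cv (f : H * H -> H) : (forall p q, f (p - q) = f p - f q) ->
    (forall p, rnorm (f p) <= pair_norm p) ->
    exists l : H, f (u n) @[n --> \oo] --> l.
  move=> fB fn; suff fc : cauchy (f (u n) @[n --> \oo]).
    have fl : cvg (f (u n) @[n --> \oo]) by exact: cauchy_cvg fc.
    by eexists; exact: fl.
  apply: cauchy_exP => _ /pos_complex[d d0 ->].
  have [N uN] := uc _ d0; exists (f (u N)), N => // n /= Nn.
  by rewrite -ball_normE /= -fB rnormE ltcR (le_lt_trans (fn _))// uN.
have [l1 ul1] := cv fst (fun _ _ => erefl) le_pair_norm1.
have [l2 ul2] := cv snd (fun _ _ => erefl) le_pair_norm2.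
exists (l1, l2); apply/pair_cvgP.
rewrite (_ : (fun n => u n) = fun n => ((u n).1, (u n).2)); last first.
  by apply/funext => n; case: (u n).
exact: cvg_pair.
Qed.

(** * The uniform boundedness principle *)

Lemma pair_cvg_norm_le (u : nat -> H * H) l p c :
  pair_cvg u l ->
  (exists N, forall n, (N <= n)%N -> pair_norm (u n - p) <= c) ->
  pair_norm (l - p) <= c.
Proof.
move=> ul [N uN]; apply/ler_addgt0Pr => e /ul[M uM].
have /uM lu := leq_maxr N M; have /uN up := leq_maxl N M.
rewrite -(subrK (u (maxn N M)) l) -addrA addrC.
by apply: le_trans (pair_normD _ _) _; apply: lerD => //; exact: ltW.
Qed.

(** The functional of p is at least r |p| somewhere on the ball of radius r
    about x, wherever the centre lies: moving from x by r in the direction of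
    p, with the sign that avoids cancellation, reaches such a point. *)
Lemma far_step (p x : H * H) (r : R) : 0 <= r ->
  exists2 y, pair_norm (y - x) <= r & r * pair_norm p <= `|rdot p y|.
Proof.
move=> r0; have [p0|p0] := eqVneq (pair_norm p) 0.
  by exists x; rewrite ?subrr ?pair_norm0 ?p0 ?mulr0.
have pp : 0 < pair_norm p by rewrite lt_def p0 pair_norm_ge0.
pose t := (if 0 <= rdot p x then r else - r) / pair_norm p.
exists (x + t%:C%C *: p).
  rewrite addrC addKr pair_normZ normrM normfV (gtr0_norm pp) divfK//.
  by case: ifP => _; rewrite ?normrN ger0_norm.
rewrite rdotDr rdotZr rdotpp /t -mulrA expr2 mulKf//.
have := mulr_ge0 r0 (ltW pp); case: (leP 0 (rdot p x)) => [h h'|h h'].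
  by rewrite ger0_norm ?addr_ge0// lerDr.
by rewrite mulNr ltr0_norm ?opprB; lra.
Qed.

(** Banach-Steinhaus for functionals on a Hilbert space, with weights w
    so that it applies to vectors that are not normalized. By the gliding hump,
    if no M works, there are indices g n with f (g n) larger than 2 n 3^n times
    its weight. Steps of length at most 3^-n produce points x n where the functional of f (g n) is at least
    3^-n |f (g n)|. The steps after the n-th add up to at most half of 3^-n,
    so the limit l retains half of this value, more than n w (g n), for every
    n. This contradicts the bound at l. *)
Lemma uniform_boundedness (I : Type) (f : I -> H * H) (w : I -> R) :
  (forall i, 0 <= w i) ->
  (forall p, exists C, forall i, `|rdot (f i) p| <= C * w i) ->
  exists2 M, 0 <= M & forall i, pair_norm (f i) <= M * w i.
Proof.
move=> w0 fw; apply: contrapT => /forallPNP h.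
have {}h (n : nat) : exists i, 2 * n%:R * 3 ^+ n * w i < pair_norm (f i).
  have := h (2 * n%:R * 3 ^+ n); rewrite !mulr_ge0 ?exprn_ge0// => /(_ isT).
  by move=> /existsNP[i /negP]; rewrite -ltNge; exists i.
have [g gP] := choice h.
pose r n : R := 3^-1 ^+ n.
have r_ge0 n : 0 <= r n by rewrite exprn_ge0.
have rS n : r n.+1 = r n / 3 by rewrite /r exprSr.
have step (nx : nat * (H * H)) : exists y, pair_norm (y - nx.2) <= r nx.1 /\
    r nx.1 * pair_norm (f (g nx.1)) <= `|rdot (f (g nx.1)) y|.
  by have [y ? ?] := far_step (f (g nx.1)) nx.2 (r_ge0 nx.1); exists y.
have [s sP] := choice step.
pose fix x n := s (n, if n is m.+1 then x m else 0).
have x_far n : r n * pair_norm (f (g n)) <= `|rdot (f (g n)) (x n)|.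
  by case: n => [|n]; [have [] := sP (0%N, 0)|have [] := sP (n.+1, x n)].
have x_step n : pair_norm (x n.+1 - x n) <= r n.+1.
  by have [] := sP (n.+1, x n).
(* the geometric sum 3^-(n+1) + ... + 3^-(n+k) in closed form *)
have x_near n k : pair_norm (x (n + k)%N - x n) <= (r n - r (n + k)%N) / 2.
  elim: k => [|k IH].
    by rewrite addn0 !subrr mul0r pair_norm0.
  rewrite addnS -(subrK (x (n + k)%N) (x _.+1)) -addrA.
  apply: le_trans (pair_normD _ _) _.
  have := x_step (n + k)%N; rewrite rS; lra.
have {}x_near n m : (n <= m)%N -> pair_norm (x m - x n) <= r n / 2.
  move=> /subnKC <-; apply: le_trans (x_near _ _) _.
  by have := r_ge0 (n + (m - n))%N; lra.
have r_small (e : R) : 0 < e -> exists n, r n < e.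
  move=> e0; have : `|3^-1 : R| < 1 by rewrite ger0_norm; lra.
  move=> /cvg_expr/cvgrPdist_lt/(_ _ e0)[n _ /(_ n (leqnn n))] /=.
  by rewrite sub0r normrN ger0_norm ?r_ge0//; exists n.
have [|l xl] := @pair_complete x.
  move=> e /r_small[N rN]; exists N => m n Nm Nn.
  rewrite -(subrK (x N) (x m)) -addrA; apply: le_lt_trans (pair_normD _ _) _.
  rewrite (pair_normB (x N)); apply: le_lt_trans rN.
  by have := x_near _ _ Nm; have := x_near _ _ Nn; lra.
have l_near n : pair_norm (l - x n) <= r n / 2.
  by apply: pair_cvg_norm_le xl _; exists n => m; exact: x_near.
have [C CP] := fw l.
pose n := (Num.truncn C).+1.
have Cn : C < n%:R by rewrite truncnS_gt.
have rdot_l : r n * pair_norm (f (g n)) / 2 <= `|rdot (f (g n)) l|.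
  have : `|rdot (f (g n)) (x n - l)| <= pair_norm (f (g n)) * (r n / 2).
    apply: le_trans (rdot_CauchySchwarz_abs _ _) _.
    by rewrite ler_wpM2l ?pair_norm_ge0// pair_normB.
  have := x_far n; rewrite -[in X in _ <= X -> _](subrK l (x n)) rdotDr.
  by have := ler_normD (rdot (f (g n)) (x n - l)) (rdot (f (g n)) l); lra.
have : r n * (2 * n%:R * 3 ^+ n * w (g n)) < r n * pair_norm (f (g n)).
  by rewrite ltr_pM2l// exprn_gt0// invr_gt0.
have -> : r n * (2 * n%:R * 3 ^+ n * w (g n)) = 2 * (n%:R * w (g n)).
  by rewrite /r exprVn; field; rewrite expf_neq0.
have := CP (g n); have := ler_wpM2r (w0 (g n)) (ltW Cn); lra.
Qed.

(** * The projection onto a closed subspace *)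

Lemma parallelogram p q : pair_norm (q - p) ^+ 2 =
  2 * (pair_norm p ^+ 2 + pair_norm q ^+ 2) - pair_norm (p + q) ^+ 2.
Proof. by rewrite !sqr_pair_normD pair_normN rdotNr (rdotC q); ring. Qed.

Lemma rdot_cvg0 (u : nat -> H * H) l f (c : R) :
  pair_cvg u l -> (forall n, rdot (u n) f ^+ 2 <= c / n.+1%:R) -> rdot l f = 0.
Proof.
move=> ul uf; apply: contrapT => /eqP; rewrite -normr_gt0.
set k := `|_| => k0.
have c0 : 0 <= c.
  apply: le_trans (sqr_ge0 (rdot (u 0%N) f)) _.
  by have := uf 0%N; rewrite divr1.
have f1 : 0 < pair_norm f + 1 by have := pair_norm_ge0 f; lra.
have [|N uN] := ul (k / 2 / (pair_norm f + 1)); first by rewrite !divr_gt0.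
have q0 : 0 < k ^+ 2 / 4 / (c + 1) by rewrite !divr_gt0 ?exprn_gt0//; lra.
have [M _ hM] := near_infty_natSinv_lt (PosNum q0).
pose n := maxn N M.
have un : `|rdot (u n) f| < k / 2.
  rewrite -(@ltr_pXn2r _ 2) ?nnegrE ?divr_ge0 ?(ltW k0)//.
  rewrite real_normK ?num_real//; apply: le_lt_trans (uf n) _.
  have /hM /= := leq_maxr N M; rewrite -/n ltr_pdivlMr; last by lra.
  have : 0 <= n.+1%:R^-1 :> R by rewrite invr_ge0.
  by set z := _^-1; nra.
have ln : `|rdot (l - u n) f| <= k / 2.
  apply: le_trans (rdot_CauchySchwarz_abs _ _) _.
  have /uN := leq_maxl N M; rewrite -/n ltr_pdivlMr// => h.
  by have := pair_norm_ge0 f; have := pair_norm_ge0 (l - u n); nra.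
have := ler_normD (rdot (l - u n) f) (rdot (u n) f).
by rewrite -rdotDl subrK -/k; lra.
Qed.

(** A minimizing sequence e n for the distance from p to E is Cauchy by the
    parallelogram law, as midpoints stay in E. For f in E, the squared length
    on the line through p - e n in the direction of f drops at most 1/(n+1)
    below its value at p - e n; by the discriminant, the square of the product
    of p - e n with f is at most |f|^2/(n+1), so the product vanishes in the
    limit. *)
Lemma orthogonal_projection (E : set (H * H)) : closed E -> E 0 ->
  (forall a p q, E p -> E q -> E (a *: p + q)) ->
  forall p, exists2 e, E e & forall f, E f -> pair_inner (p - e) f = 0.
Proof.
move=> clE E0 linE p.
pose dist2 := [set pair_norm (p - e) ^+ 2 | e in E].
have dist2_inf : has_inf dist2.
  split; first by exists (pair_norm (p - 0) ^+ 2), 0.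
  by exists 0 => _ [e _ <-]; exact: sqr_ge0.
pose d := inf dist2.
have d_le e : E e -> d <= pair_norm (p - e) ^+ 2.
  by move=> Ee; apply: ge_inf (proj2 dist2_inf) _ _; exists e.
have d_app (n : nat) :
    exists e, E e /\ pair_norm (p - e) ^+ 2 <= d + n.+1%:R^-1.
  have [|_ [e Ee <-] /ltW de] := @inf_adherent _ dist2 n.+1%:R^-1 _ dist2_inf.
    by rewrite invr_gt0.
  by exists e.
have [e eP] := choice d_app.
have Ee n : E (e n) by have [] := eP n.
have e_min n : pair_norm (p - e n) ^+ 2 <= d + n.+1%:R^-1 by have [] := eP n.
have e_dist m n : pair_norm (e m - e n) ^+ 2 <= 2 * (m.+1%:R^-1 + n.+1%:R^-1).
  pose h := (2^-1 : R)%:C%C.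
  have hE : E (h *: e m + (h *: e n + 0)) by exact/linE/linE.
  have := d_le _ hE; have := e_min m; have := e_min n.
  pose a := p - e m; pose b := p - e n.
  have -> : p - (h *: e m + (h *: e n + 0)) = h *: (a + b).
    have hh : h + h = 1.
      by rewrite -rmorphD (_ : 2^-1 + 2^-1 = 1 :> R) ?rmorph1//; lra.
    rewrite /a /b addr0 -scalerDr -[in LHS](scale1r p) -hh scalerDl.
    by rewrite -scalerDr -scalerBr opprD addrACA.
  have -> : e m - e n = b - a.
    by rewrite /a /b opprB addrC [RHS]addrC addrA subrK addrC.
  rewrite -/a -/b pair_normZ ger0_norm ?invr_ge0// exprMn.
  rewrite parallelogram (_ : 2^-1 ^+ 2 = 4^-1); last by field.
  by set x := m.+1%:R^-1; set y := n.+1%:R^-1; lra.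
have e_cauchy : pair_cauchy e.
  move=> eps eps0; have : 0 < eps ^+ 2 / 4 by rewrite divr_gt0 ?exprn_gt0.
  move=> h; have [N _ hN] := near_infty_natSinv_lt (PosNum h).
  exists N => m n /hN /= hm /hN /= hn.
  rewrite -(@ltr_pXn2r _ 2) ?nnegrE ?pair_norm_ge0 ?(ltW eps0)//.
  apply: le_lt_trans (e_dist m n) _.
  by move: hm hn; set x := m.+1%:R^-1; set y := n.+1%:R^-1; lra.
have [l el] := pair_complete e_cauchy.
exists l.
  by apply: (@closed_cvg _ _ \oo _ e E clE) ((pair_cvgP e l).1 el); exists 0%N.
have rdot0 f : E f -> rdot (p - l) f = 0.
  move=> Ef; apply: (@rdot_cvg0 (fun n => p - e n) _ _ (pair_norm f ^+ 2)).
    move=> eps /el[N eN]; exists N => n /eN ln /=.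
    by rewrite opprB addrC addrA subrK pair_normB.
  move=> n; rewrite mulrC; apply: discr_le (sqr_ge0 _) _ => t.
  have Eet : E (t%:C%C *: f + e n) by exact: linE.
  have := d_le _ Eet; rewrite opprD addrA addrAC sqr_pair_normBZ.
  by have := e_min n; set x := n.+1%:R^-1; lra.
(* the real part of the product with 'i f is minus the imaginary part *)
move=> f Ef; have iEf : E ('i%C *: f) by rewrite -[_ *: f]addr0; exact: linE.
rewrite pair_innerC (_ : pair_inner f (p - l) = 0) ?rmorph0//.
have := rdot0 _ Ef; have := rdot0 _ iEf.
rewrite !(rdotC (p - l)) /rdot pair_innerZl.
case: (pair_inner f _) => a b /= h1 h2; apply/eqP.
by rewrite eq_complex /=; apply/andP; split; apply/eqP; lra.
Qed.

End OrthogonalSum.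

(** * The symplectic form *)

Section Symplectic.
Variables (R : realType) (H : hilbertType R).
Implicit Types p q : (H * H)%type.

(** The complex structure J that turns the inner product into the symplectic
    form; J^2 = - 1. *)
Definition twist p : H * H := (p.2, - p.1).

Lemma omega_pairE p q : omega_pair p q = pair_inner p (twist q).
Proof. by rewrite /omega_pair /pair_inner /= linearNr. Qed.

Lemma omega_pairNr p q : omega_pair p (- q) = - omega_pair p q.
Proof. by rewrite /omega_pair /= !linearNr opprD. Qed.

Lemma pair_norm_twist p : pair_norm (twist p) = pair_norm p.
Proof. by rewrite /pair_norm /= /rnorm normrN [in LHS]addrC. Qed.

Lemma twistK p : twist (- twist p) = p.
Proof. by case: p => a b; rewrite /twist /= !opprK. Qed.

Lemma Re_omega_le p q :
  `|complex.Re (omega_pair p q)| <= pair_norm p * pair_norm q.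
Proof.
rewrite omega_pairE -(pair_norm_twist q); exact: rdot_CauchySchwarz_abs.
Qed.

Lemma Re_omega_twist p :
  complex.Re (omega_pair p (- twist p)) = pair_norm p ^+ 2.
Proof. by rewrite omega_pairE twistK -rdotpp. Qed.

End Symplectic.

(** * The orthogonal complement of the graph of A *)

Section Decomposition.
Variables (R : realType) (H : hilbertType R) (D : submodClosed H).
Variable A : {linear sublmod D -> H}.

Definition adj_graph (x : sublmod (adj_dom A)) : H * H := (val x, adj x).

Lemma graph_normE x : graph_norm x = pair_norm (adj_graph x).
Proof. by []. Qed.

Lemma graph_norms_has_inf q :
  has_inf [set graph_norm x | x in [set x | \pi_(dom_quot A) x = q]].
Proof.
split; first by exists (graph_norm (repr q)), (repr q); rewrite //= reprK.
by exists 0 => _ [x _ <-]; exact: sqrtr_ge0.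
Qed.

Lemma quot_norm_le x : quot_norm (\pi_(dom_quot A) x) <= graph_norm x.
Proof. by apply: ge_inf (proj2 (graph_norms_has_inf _)) _ _; exists x. Qed.

Lemma le_quot_norm (c : R) q :
  (forall x, \pi_(dom_quot A) x = q -> c <= graph_norm x) -> c <= quot_norm q.
Proof.
move=> h; apply: lb_le_inf (proj1 (graph_norms_has_inf q)) _ => _ [x xq <-].
exact: h.
Qed.

Hypotheses (dA : densely_defined D) (sA : symmetric_op A).

Lemma dom_sub_adj_dom (u : sublmod D) : val u \in adj_dom A.
Proof. by apply/asboolP; exists (A u) => v; exact: sA. Qed.

Lemma omega_dom_graph x y :
  omega_dom (\pi_(dom_quot A) x) (\pi_(dom_quot A) y) =
  - omega_pair (adj_graph x) (adj_graph y).
Proof. by rewrite omega_domE// opprB. Qed.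

(** The vectors orthogonal to the graph of A inside the graph of A^* are the
    (z, A^* z) with A^* A^* z = - z: testing against all (v, A v) says exactly
    that A^* z is in the domain of A^* and is mapped to - z. The class of x
    modulo dom(A) contains such a z because x - z comes from the projection of
    (x, A^* x) onto the graph of A. *)
Lemma von_neumann_decomposition (x : sublmod (adj_dom A)) : closed_op A ->
  exists z w : sublmod (adj_dom A),
    \pi_(dom_quot A) x = \pi_(dom_quot A) z /\
    adj_graph w = twist (adj_graph z).
Proof.
move=> clA.
have [||_ [u _ <-] uP] := orthogonal_projection clA _ _ (adj_graph x).
- by exists 0; rewrite ?linear0.
- move=> a _ _ [u _ <-] [v _ <-]; exists (a *: u + v) => //.
  by rewrite !linearP.
pose u' := SubLmod (dom_sub_adj_dom u); pose z := x - u'.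
have zv : val z = val x - val u by rewrite /z linearB.
have zE : adj_graph z = adj_graph x - (val u, A u).
  rewrite /adj_graph zv; congr pair.
  have := adj_linear dA (-1) u' x; rewrite !scaleN1r (addrC _ x) => ->.
  by rewrite addrC (adj_restr dA sA (erefl : val u' = val u)).
have wP (v : sublmod D) : inner (A v) (adj z) = inner (val v) (- val z).
  have : pair_inner (val v, A v) (adj_graph z) = 0.
    by rewrite pair_innerC zE uP ?rmorph0//; exists v.
  rewrite /pair_inner /= addrC => /eqP; rewrite addr_eq0 => /eqP ->.
  by rewrite linearNr.
have w_dom : adj z \in adj_dom A by apply/asboolP; exists (- val z).
exists z, (SubLmod w_dom); split.
  by apply/pi_dom_quotP; rewrite zv opprB addrC subrK; exact: valP.
have aw : adj (SubLmod w_dom) = - val z by apply: adj_unique.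
by rewrite /adj_graph aw.
Qed.

End Decomposition.

(** * The boundary trace *)

Section Trace.
Variables (R : realType) (H G : hilbertType R) (D : submodClosed H).
Variables (A : {linear sublmod D -> H})
  (G1 G2 : {linear sublmod (adj_dom A) -> G}).
Hypotheses (dA : densely_defined D) (sA : symmetric_op A) (clA : closed_op A).
Hypothesis bt : boundary_triple G1 G2.

Definition trace (x : sublmod (adj_dom A)) : G * G := (G1 x, G2 x).

Lemma trace_linear : linear trace.
Proof. by move=> a x y; rewrite /trace !linearP. Qed.

Lemma trace_surj p : exists x, trace x = p.
Proof.
by case: p => u v; have [x [xu xv]] := bt.2 u v; exists x; rewrite /trace xu xv.
Qed.

Lemma green x y : omega_pair (trace x) (trace y) =
  omega_dom (\pi_(dom_quot A) x) (\pi_(dom_quot A) y).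
Proof. by rewrite omega_domE// bt.1. Qed.

(** The difference of the traces is paired to its own squared norm by some
    trace, and Green's identity makes that pairing vanish. *)
Lemma trace_pi x y :
  \pi_(dom_quot A) x = \pi_(dom_quot A) y -> trace x = trace y.
Proof.
move=> xy; apply/eqP; rewrite -subr_eq0; apply/eqP/pair_norm_eq0/eqP.
have [f ft] := trace_surj (- twist (trace x - trace y)).
rewrite -sqrf_eq0 -Re_omega_twist -ft omega_pairE pair_innerDl.
rewrite -scaleN1r pair_innerZl mulN1r -!omega_pairE !green xy.
by rewrite subrr.
Qed.

(** Pairing with a fixed trace is bounded in the graph norm by Green's identity,
    so the traces are weakly bounded relative to the graph norm. *)
Lemma trace_bounded :
  exists2 M, 0 <= M & forall x, pair_norm (trace x) <= M * graph_norm x.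
Proof.
apply: uniform_boundedness => [x|p]; first exact: sqrtr_ge0.
have [y yp] := trace_surj (- twist p).
exists (graph_norm y) => x.
rewrite -[p]twistK -yp /rdot -omega_pairE green omega_dom_graph//.
rewrite -omega_pairNr mulrC.
by apply: le_trans (Re_omega_le _ _) _; rewrite pair_normN.
Qed.

(** Pairing the reduced representative z with w = A^* z by Green's identity
    recovers the squared graph norm of z, while the trace of w is bounded by M
    times the graph norm of w, which is that of z. *)
Lemma small_representative M : 0 <= M ->
  (forall x, pair_norm (trace x) <= M * graph_norm x) -> forall x, exists2 z,
  \pi_(dom_quot A) z = \pi_(dom_quot A) x &
  graph_norm z <= M * pair_norm (trace x).
Proof.
move=> M0 trM x; have [z [w [xz wz]]] := von_neumann_decomposition dA sA x clA.
exists z => //; rewrite (trace_pi xz).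
have zw : graph_norm z ^+ 2 <= pair_norm (trace z) * (M * graph_norm z).
  have wn : graph_norm w = graph_norm z.
    by rewrite !graph_normE wz pair_norm_twist.
  have := trM w; rewrite wn => /(ler_wpM2l (pair_norm_ge0 (trace z))).
  apply: le_trans.
  apply: le_trans (Re_omega_le _ _); apply: le_trans (ler_norm _).
  rewrite green omega_dom_graph// wz -omega_pairNr Re_omega_twist.
  by rewrite graph_normE.
have [z0|z0] := leP (graph_norm z) 0.
  by apply: le_trans z0 _; rewrite mulr_ge0 ?pair_norm_ge0.
by rewrite -(ler_pM2r z0) -expr2 (le_trans zw)// mulrCA mulrA.
Qed.

End Trace.

(** * The symplectomorphism *)

Theorem proposition5p3 (R : realType) (H G : hilbertType R)
    (D : submodClosed H) (A : {linear sublmod D -> H})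
    (G1 G2 : {linear sublmod (adj_dom A) -> G}) :
  separable H -> separable G ->
  densely_defined D -> symmetric_op A -> closed_op A ->
  same_dim (ker_adj_sub A 'i) (ker_adj_sub A (- 'i)) ->
  boundary_triple G1 G2 ->
  exists Tr : {linear dom_quot A -> (G * G)%type},
    [/\ forall x : sublmod (adj_dom A), Tr (\pi_(dom_quot A) x) = (G1 x, G2 x),
        bounded_map (@quot_norm R H D A) (@pair_norm R G) Tr,
        exists2 S : {linear (G * G)%type -> dom_quot A},
          cancel Tr S /\ cancel S Tr &
          bounded_map (@pair_norm R G) (@quot_norm R H D A) S &
        forall q r : dom_quot A, omega_dom q r = omega_pair (Tr q) (Tr r)].
Proof.
move=> _ _ dA sA clA _ bt.
pose T (q : dom_quot A) := trace G1 G2 (repr q).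
have Tpi x : T (\pi_(dom_quot A) x) = trace G1 G2 x.
  by apply: (trace_pi dA sA bt); rewrite reprK.
have Tlin : linear T.
  move=> a; elim/quotW=> x; elim/quotW=> y.
  have -> : a *: \pi_(dom_quot A) x + \pi_(dom_quot A) y =
      \pi_(dom_quot A) (a *: x + y).
    by rewrite raddfD; congr (_ + _); exact: dom_quot_scaleE.
  by rewrite !Tpi trace_linear.
have [M M0 trM] := trace_bounded dA sA bt.
have repM := small_representative dA sA clA bt M0 trM.
(* a class of zero trace has a representative of zero graph norm *)
have Tinj : injective T.
  have T0 q : T q = 0 -> q = 0.
    elim/quotW: q => x; rewrite Tpi => x0.
    have [z <-] := repM x; rewrite x0 pair_norm0.
    rewrite mulr0 graph_normE => z0.
    have [vz _] : adj_graph z = 0.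
      by apply: pair_norm_eq0; apply/eqP; rewrite eq_le z0 pair_norm_ge0.
    by rewrite (_ : z = 0) ?raddf0//; apply: val_inj; rewrite linear0.
  move=> q r qr; apply/eqP; rewrite -subr_eq0; apply/eqP/T0.
  have := Tlin (-1) r q; rewrite !scaleN1r (addrC _ q) => ->.
  by rewrite qr addNr.
have [S0 S0P] := choice (trace_surj bt).
pose S p : dom_quot A := \pi_(dom_quot A) (S0 p).
have SK : cancel S T by move=> p; rewrite /S Tpi S0P.
have TK : cancel T S by move=> q; apply: Tinj; rewrite SK.
have Slin : linear S by move=> a p q; apply: Tinj; rewrite Tlin !SK.
pose Tr : {linear dom_quot A -> (G * G)%type} :=
  HB.pack T (GRing.isLinear.Build _ _ _ _ T Tlin).
pose Sr : {linear (G * G)%type -> dom_quot A} :=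
  HB.pack S (GRing.isLinear.Build _ _ _ _ S Slin).
exists Tr; split => //.
- exists M; elim/quotW => x; rewrite [Tr _]Tpi.
  have [M_eq0|Mn0] := eqVneq M 0.
    by rewrite M_eq0 mul0r -(mul0r (graph_norm x)) -M_eq0 trM.
  rewrite mulrC -ler_pdivrMr ?lt_def ?Mn0//; apply: le_quot_norm => y yx.
  by rewrite ler_pdivrMr ?lt_def ?Mn0// -(trace_pi dA sA bt yx) mulrC.
- exists Sr => //; exists M => p.
  have [z zp zM] := repM (S0 p); rewrite S0P in zM.
  by apply: le_trans zM; rewrite /= /S -zp quot_norm_le.
- elim/quotW=> x; elim/quotW=> y; rewrite [Tr _]Tpi [Tr (\pi y)]Tpi.
  by rewrite (green dA sA bt).
Qed.
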